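(* Let $p,q\in\mathbb{Z}$, let $(G_n)_{n\ge0}$ be the sequence defined by $G_0=0$, $G_1=1$ and $G_n=pG_{n-1}+qG_{n-2}$ for $n\ge2$, and let $r=p^2+4q\neq0$. (1) For every positive integer $s$ with $s\mid r$ and for all integers $k,n\ge0$, we have $s^kG_n\mid G_{s^kn}$. (2) Suppose that one of the following holds: (a) $p$ is odd, $\gcd(p,q)=1$ and $s$ is a positive integer with $s\mid r$; or (b) $p$ is even, $\gcd(p/2,q)=1$ and $s$ is a positive integer with $s\mid r/4$; or (c) $\gcd(p,q)=1$ and $s\ge3$ is a prime with $s\mid r$. If $3\nmid q+1$ or $3\nmid s$, then for all integers $k,n\ge0$: $s^k\mid n$ if and only if $s^k\mid G_n$.
   Context: For integers $a,b$, $a\mid b$ means there is an integer $c$ with $b=ca$ (in particular $0\mid 0$); $\gcd$ denotes the greatest common divisor. *)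

(* Defs.v *)
From mathcomp Require Import all_boot all_order all_algebra.

Set Implicit Arguments.
Unset Strict Implicit.
Unset Printing Implicit Defensive.

Import Order.TTheory GRing.Theory Num.Theory.

Local Open Scope ring_scope.

Fixpoint lucas_seq (p q : int) (n : nat) : int :=
  match n with
  | 0 => 0
  | 1 => 1
  | (n2.+1 as n1).+1 => p * lucas_seq p q n1 + q * lucas_seq p q n2
  end.

Definition lucas_disc (p q : int) : int := p ^+ 2 + 4 * q.

(* In the second case p is even, so 4 divides lucas_disc p q and both
   Euclidean quotients below are exact. *)
Definition admissible (p q : int) (s : nat) : Prop :=
  [\/ [/\ ~~ (2 %| p)%Z, gcdz p q = 1, (0 < s)%N & (s %| lucas_disc p q)%Z],
      [/\ (2 %| p)%Z, gcdz (p %/ 2)%Z q = 1, (0 < s)%N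
        & (s %| (lucas_disc p q %/ 4)%Z)%Z]
    | [/\ gcdz p q = 1, (3 <= s)%N, prime s & (s %| lucas_disc p q)%Z]].

(* Main.v *)
(* With V_n = 2 G_{n+1} - p G_n, the quotient G_{mn} / G_n is the m-th Lucas
   number with parameters V_n and -(-q)^n, whose discriminant is r G_n^2. Hence
   (1) reduces to l | G_l for a prime l | r, which follows from
   2^n G_{n+1} = (n+1) p^n modulo r. In (2) the hypotheses force 3 not to
   divide s, because 3 | r and 3 not dividing p give q = -p^2 = -1 modulo 3.
   For an odd prime l | s, expanding 2^n G_{n+1} modulo r^2 shows that l^2 does
   not divide G_l, so G_{ln} / G_n is divisible by l exactly once; for l = 2 the
   quotient is V_n, which is twice an odd number. As l | G_n only if l | n, the
   numbers G_n and n are divisible by the same powers of l. *)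

Require Import Defs.
From mathcomp Require Import all_boot all_order all_algebra.
From mathcomp Require Import ring zify.

Set Implicit Arguments.
Unset Strict Implicit.
Unset Printing Implicit Defensive.

Import Order.TTheory GRing.Theory Num.Theory.

Local Open Scope ring_scope.

(** * Prime divisors of integers *)

Lemma prime_coprimez (l : nat) (x : int) :
  prime l -> coprimez l x = ~~ (l %| x)%Z.
Proof. by move=> l_pr; rewrite coprimezE prime_coprime. Qed.

Lemma Euclid_dvdzM (l : nat) (x y : int) :
  prime l -> (l %| x * y)%Z = (l %| x)%Z || (l %| y)%Z.
Proof. by move=> l_pr; rewrite !dvdzE abszM Euclid_dvdM. Qed.

Lemma Euclid_dvdzX (l : nat) (x : int) (n : nat) :
  prime l -> (l %| x ^+ n)%Z = (l %| x)%Z && (0 < n)%N.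
Proof. by move=> l_pr; rewrite !dvdzE abszX Euclid_dvdX. Qed.

Lemma lucas_seqSS p q n :
  lucas_seq p q n.+2 = p * lucas_seq p q n.+1 + q * lucas_seq p q n.
Proof. by []. Qed.

(** * Identities and congruences for Lucas sequences *)

Section LucasSequence.

Variables p q : int.
Local Notation G := (lucas_seq p q).
Local Notation r := (lucas_disc p q).

(** This is G_{m+n} = G_m G_{n+1} + q G_{m-1} G_n with q G_{m-1} written as G_{m+1} - p G_m, so that
    m = 0 is covered. *)
Lemma lucas_seqD m n : G (m + n) = G m * G n.+1 + G m.+1 * G n - p * G m * G n.
Proof.
elim/ltn_ind: m => -[|[|m]] IH.
- by rewrite add0n /=; ring.
- by rewrite add1n lucas_seqSS /=; ring.
rewrite !addSn lucas_seqSS -addSn !IH // !lucas_seqSS.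
by ring.
Qed.

(** If alpha, beta are the roots of X^2 - p X - q, the left side is the product of G_{n+1} - alpha
    G_n = beta^n and G_{n+1} - beta G_n = alpha^n. *)
Lemma lucas_cassini n :
  G n.+1 ^+ 2 - p * G n * G n.+1 - q * G n ^+ 2 = (- q) ^+ n.
Proof.
elim: n => [|n IHn]; first by rewrite /=; ring.
by rewrite [RHS]exprS -IHn lucas_seqSS; ring.
Qed.

(** The companion Lucas sequence alpha^n + beta^n, with V_0 = 2 and V_1 = p. *)
Definition lucas_companion n : int := 2 * G n.+1 - p * G n.
Local Notation V := lucas_companion.

Lemma lucas_companion_disc n : lucas_disc (V n) (- (- q) ^+ n) = r * G n ^+ 2.
Proof. by rewrite /lucas_disc -lucas_cassini /V; ring. Qed.

(** The roots of X^2 - V_n X + (-q)^n are alpha^n and beta^n. *)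
Lemma lucas_seqM m n : G (m * n) = lucas_seq (V n) (- (- q) ^+ n) m * G n.
Proof.
elim/ltn_ind: m => -[|[|m]] IH.
- by rewrite mul0n mul0r.
- by rewrite mul1n mul1r.
rewrite lucas_seqSS mulrDl -!mulrA -!IH // !mulSn.
rewrite [G (n + (n + _))]lucas_seqD -addnS !lucas_seqD lucas_seqSS.
by rewrite -lucas_cassini /V; ring.
Qed.

(** Modulo r the polynomial X^2 - p X - q has the double root p/2; the factor 2^n clears
    denominators. *)
Lemma lucas_seq_mod_disc n :
  exists x, 2 ^+ n * G n.+1 = n.+1%:R * p ^+ n + r * x.
Proof.
elim/ltn_ind: n => -[|[|n]] IH.
- by exists 0; rewrite /=; ring.
- by exists 0; rewrite /=; ring.
have [x Ex] := IH n (ltnW (ltnSn _)); have [y Ey] := IH n.+1 (ltnSn _).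
exists (2 * p * y + 4 * q * x + n.+1%:R * p ^+ n).
have -> : 2 ^+ n.+2 * G n.+3 =
    2 * p * (2 ^+ n.+1 * G n.+2) + (r - p ^+ 2) * (2 ^+ n * G n.+1).
  by rewrite (lucas_seqSS p q n.+1) /lucas_disc !exprS; ring.
by rewrite Ex Ey /lucas_disc !exprS -!natr1; ring.
Qed.

(** These are the first two terms of 2^{N-1} G_N = sum_j C(N, 2j+1) p^{N-1-2j} r^j, the binomial
    expansion of ((p + sqrt r)^N - (p - sqrt r)^N) / (2 sqrt r). Taking N = n + 3 keeps the
    exponents of p natural. *)
Lemma lucas_seq_mod_disc2 n :
  exists x, 2 ^+ n.+2 * G n.+3 =
    n.+3%:R * p ^+ n.+2 + 'C(n.+3, 3)%:R * p ^+ n * r + r ^+ 2 * x.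
Proof.
elim/ltn_ind: n => -[|[|n]] IH.
- by exists 0; rewrite /lucas_disc /= binn; ring.
- by exists 0; rewrite /lucas_disc /= (_ : 'C(4, 3) = 4%N) //; ring.
have [x Ex] := IH n (ltnW (ltnSn _)); have [y Ey] := IH n.+1 (ltnSn _).
exists (2 * p * y + 4 * q * x + 'C(n.+3, 3)%:R * p ^+ n).
have -> : 2 ^+ n.+4 * G n.+4.+1 =
    2 * p * (2 ^+ n.+3 * G n.+4) + (r - p ^+ 2) * (2 ^+ n.+2 * G n.+3).
  by rewrite (lucas_seqSS p q n.+3) /lucas_disc !exprS; ring.
rewrite Ex Ey (binS n.+4 2) (binS n.+3 2) (binS n.+3 1) bin1 /lucas_disc.
by rewrite !natrD !exprS -!natr1; ring.
Qed.

Lemma dvdz_lucas_seq_prime (l : nat) : prime l -> (l %| r)%Z -> (l %| G l)%Z.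
Proof.
move=> l_pr l_r; have [l2|l_odd] := even_prime l_pr.
  (* Here 2 is not invertible, but G_2 = p and r = p^2 modulo 2. *)
  move: l_r; rewrite l2 /lucas_disc /= mulr0 addr0 mulr1.
  by rewrite rpredDr ?Euclid_dvdzX ?andbT // dvdz_mulr.
have [x] := lucas_seq_mod_disc l.-1.
rewrite prednK ?prime_gt0 // => E.
have : (l %| 2 ^+ l.-1 * G l)%Z by rewrite E rpredD ?dvdz_mulr // natz.
by rewrite Gauss_dvdzr // coprimezXr // coprimezE coprime_sym coprime2n.
Qed.

(* The prime 3 is excluded because the term 'C(3, 3) * r may cancel 3 * p ^ 2
   modulo 9. *)
Lemma lucas_seq_prime_ndvd_sqr (l : nat) :
  prime l -> (3 < l)%N -> (l %| r)%Z -> ~~ (l %| p)%Z ->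
  ~~ (l%:Z ^+ 2 %| G l)%Z.
Proof.
move=> l_pr l_gt3 l_r l_p; apply/negP => l2_G.
have [n def_l] : exists n, l = n.+3 by exists (l - 3)%N; lia.
have [x] := lucas_seq_mod_disc2 n; rewrite -def_l => E.
have : (l%:Z ^+ 2 %| l%:R * p ^+ n.+2)%Z.
  have -> : l%:R * p ^+ n.+2 =
      2 ^+ n.+2 * G l - 'C(l, 3)%:R * p ^+ n * r - r ^+ 2 * x.
    by rewrite E; ring.
  (* As l > 3, l divides C(l, 3), so the term in r vanishes modulo l^2. *)
  have l_C : (l %| 'C(l, 3)%:R * p ^+ n)%Z.
    by rewrite dvdz_mulr // natz dvdzE /= prime_dvd_bin.
  apply: rpredB; last by rewrite dvdz_mulr ?dvdz_exp2r.
  by apply: rpredB; [rewrite dvdz_mull | rewrite expr2 dvdz_mul].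
rewrite natz expr2 dvdz_mul2l ?Euclid_dvdzX ?andbT ?(negPf l_p) //.
by rewrite -lt0n prime_gt0.
Qed.

End LucasSequence.

(** * Statement (1) *)

Lemma dvdz_lucas_seqM p q s k n : (0 < s)%N -> (s %| lucas_disc p q)%Z ->
  (s%:Z ^+ k * lucas_seq p q n %| lucas_seq p q (s ^ k * n))%Z.
Proof.
move=> s_gt0 s_r; elim: k => [|k IHk]; first by rewrite expr0 expn0 mul1r mul1n.
rewrite exprS -mulrA expnS -mulnA.
(* It suffices to gain one factor s, that is s G_n | G_{s n} for every n; this goes by strong
   induction on s, splitting off a prime l. *)
apply: dvdz_trans (dvdz_mul (dvdzz s) IHk) _; move: (s ^ k * n)%N => {IHk k n}.
elim/ltn_ind: s s_gt0 s_r => s IHs s_gt0 s_r n.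
have [s1|s_gt1] := leqP s 1.
  have -> : s = 1%N by lia.
  by rewrite mul1r mul1n dvdzz.
have l_pr := pdiv_prime s_gt1; have := pdiv_dvd s.
move: (pdiv s) l_pr => l l_pr /dvdnP[t def_s].
move: s_gt0 s_r; rewrite {}def_s in IHs s_gt1 *.
rewrite muln_gt0 => /andP[t_gt0 _].
rewrite PoszM => s_r.
have t_r := dvdz_trans (dvdz_mulr l (dvdzz t)) s_r.
have l_r := dvdz_trans (dvdz_mull t (dvdzz l)) s_r.
rewrite (mulnC t) -mulnA lucas_seqM.
rewrite [_ * l%:Z]mulrC -mulrA dvdz_mul //.
  by rewrite dvdz_lucas_seq_prime // lucas_companion_disc dvdz_mulr.
by apply: IHs => //; rewrite ltn_Pmulr ?prime_gt1.
Qed.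

(** * Powers of a single prime dividing G_n *)

Section PrimePower.

Variables (p q : int) (l : nat).
Hypothesis l_pr : prime l.
Local Notation G := (lucas_seq p q).
Local Notation r := (lucas_disc p q).
Local Notation V := (lucas_companion p q).

(** In G_{l m} = H G_m the factor H is divisible by l because its discriminant is, and only once by
    the last hypothesis. So a factor l can be removed from l m and from G_{l m} together, which
    gives the induction on k. *)
Lemma prime_power_dvd_lucas_seq k n :
    (l %| r)%Z -> (forall n, (l %| G n)%Z -> (l %| n)%N) ->
    (forall n, ~~ (l%:Z ^+ 2 %| lucas_seq (V n) (- (- q) ^+ n) l)%Z) ->
  (l ^ k %| n)%N = (l%:Z ^+ k %| G n)%Z.
Proof.
move=> l_r l_G l2_G; elim: k n => [|k IHk] n; first by rewrite dvd1n dvd1z.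
apply/idP/idP=> [/dvdnP[m ->]|lk_n].
  rewrite mulnC; apply: dvdz_trans (dvdz_lucas_seqM _ _ (prime_gt0 _) _) => //.
  by rewrite dvdz_mulr.
have /dvdnP[m def_n] : (l %| n)%N.
  by apply/l_G/dvdz_trans/lk_n; rewrite exprS dvdz_mulr.
have l_neq0 : l%:Z != 0 by rewrite -lt0n prime_gt0.
rewrite {}def_n in lk_n *; rewrite expnSr dvdn_pmul2r ?prime_gt0 // IHk.
move: lk_n; rewrite mulnC lucas_seqM.
have /dvdzP[h def_H] : (l %| lucas_seq (V m) (- (- q) ^+ m) l)%Z.
  by rewrite dvdz_lucas_seq_prime // lucas_companion_disc dvdz_mulr.
move: (l2_G m); rewrite {}def_H expr2 dvdz_mul2r // => l_h.
rewrite exprSr mulrAC dvdz_mul2r // Gauss_dvdzr //.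
by rewrite coprimezXl // prime_coprimez.
Qed.

Lemma odd_prime_power_dvd_lucas_seq k n :
    (3 < l)%N -> (l %| r)%Z -> ~~ (l %| p)%Z ->
  (l ^ k %| n)%N = (l%:Z ^+ k %| G n)%Z.
Proof.
move=> l_gt3 l_r l_p.
have l_2 : (l %| 2)%Z = false by rewrite dvdzE /= gtnNdvd // ltnW.
have l_q : ~~ (l %| q)%Z.
  apply: contra l_p => l_q; move: l_r.
  rewrite /lucas_disc rpredDr; last by rewrite dvdz_mull.
  by rewrite Euclid_dvdzX // andbT.
apply: prime_power_dvd_lucas_seq => // [[|m] l_G|m]; first by rewrite dvdn0.
  have [x E] := lucas_seq_mod_disc p q m.
  have : (l %| m.+1%:R * p ^+ m)%Z.
    have -> : m.+1%:R * p ^+ m = 2 ^+ m * G m.+1 - r * x by rewrite E; ring.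
    by apply: rpredB; [rewrite dvdz_mull | rewrite dvdz_mulr].
  by rewrite Euclid_dvdzM // Euclid_dvdzX // (negPf l_p) orbF natz.
apply: lucas_seq_prime_ndvd_sqr => //.
  by rewrite lucas_companion_disc dvdz_mulr.
(* The first parameter V_m must be prime to l: modulo l, V_m^2 = 4 (-q)^m because l | r. *)
apply: contra l_q => l_V.
have := lucas_companion_disc p q m; rewrite /lucas_disc => E.
have : (l %| 2 ^+ 2 * (- q) ^+ m)%Z.
  have -> : 2 ^+ 2 * (- q) ^+ m = V m ^+ 2 - r * G m ^+ 2.
    by rewrite -E; ring.
  by rewrite rpredB ?dvdz_mulr.
by rewrite Euclid_dvdzM // !Euclid_dvdzX // l_2 rpredN => /andP[].
Qed.

End PrimePower.

(** The quotient V_m is 2 W with W = G_{m+1} - a G_m, and W is odd since W^2 = (-q)^m + (a^2 + q)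
    G_m^2 with a^2 + q even. *)
Lemma two_power_dvd_lucas_seq a q k n :
    ~~ (2 %| a)%Z -> ~~ (2 %| q)%Z ->
  (2 ^ k %| n)%N = (2%:Z ^+ k %| lucas_seq (a * 2) q n)%Z.
Proof.
move=> a_odd q_odd; apply: prime_power_dvd_lucas_seq => //.
- by rewrite /lucas_disc; apply/dvdzP; exists (2 * a ^+ 2 + 2 * q); ring.
(* Modulo 2, G_{n+2} = G_n, so G_n has the parity of n. *)
- move=> {}n; elim/ltn_ind: n => -[|[|n]] IHn //.
  rewrite lucas_seqSS rpredDl; last by rewrite dvdz_mulr ?dvdz_mull.
  rewrite Euclid_dvdzM // (negPf q_odd) => /(IHn n (ltnW (ltnSn _))).
  by rewrite -[n.+2]addn2 dvdn_addl.
move=> m; rewrite lucas_seqSS /= mulr0 addr0 mulr1 /lucas_companion.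
have -> : 2 * lucas_seq (a * 2) q m.+1 - a * 2 * lucas_seq (a * 2) q m =
  2 * (lucas_seq (a * 2) q m.+1 - a * lucas_seq (a * 2) q m) by ring.
rewrite expr2 dvdz_mul2l //; apply/negP => even_W.
have even_D : (2 %| a ^+ 2 + q)%Z.
  have : ~~ (2 %| a ^+ 2)%Z by rewrite Euclid_dvdzX // andbT.
  by move: q_odd; lia.
have : (2 %| (- q) ^+ m)%Z.
  have -> : (- q) ^+ m =
      (lucas_seq (a * 2) q m.+1 - a * lucas_seq (a * 2) q m) ^+ 2
      - (a ^+ 2 + q) * lucas_seq (a * 2) q m ^+ 2.
    by rewrite -(lucas_cassini (a * 2)); ring.
  by apply: rpredB; rewrite ?Euclid_dvdzX ?even_W // dvdz_mulr.
by rewrite Euclid_dvdzX // rpredN (negPf q_odd).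
Qed.

(** * From prime powers to powers of s *)

Lemma dvd_lucas_seq_by_primes p q d n : (0 < d)%N ->
    (forall l k, prime l -> (l %| d)%N ->
       (l ^ k %| n)%N = (l%:Z ^+ k %| lucas_seq p q n)%Z) ->
  (d %| n)%N = (d %| lucas_seq p q n)%Z.
Proof.
move=> d_gt0 Hl; rewrite dvdzE.
apply/(dvdn_partP _ d_gt0)/(dvdn_partP _ d_gt0) => H l l_d;
  have := H l l_d; move: l_d; rewrite mem_primes p_part => /and3P[l_pr _ l_d];
  by rewrite Hl // dvdzE abszX.
Qed.

(** Used with c = 4 for r = p^2 + 4 q and with c = 1 for r/4 = (p/2)^2 + q. *)
Lemma prime_ndvd_of_coprime (l : nat) (c x y : int) :
    prime l -> ~~ (l %| c)%Z -> gcdz x y = 1 -> (l %| x ^+ 2 + c * y)%Z ->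
  ~~ (l %| x)%Z.
Proof.
move=> l_pr l_c xy1; apply: contraL => l_x; apply/negP.
rewrite rpredDl; last by rewrite Euclid_dvdzX // andbT.
rewrite Euclid_dvdzM // (negPf l_c) => l_y.
have : (l %| gcdz x y)%Z by rewrite dvdz_gcd l_x.
by rewrite xy1 dvdzE /= Euclid_dvd1.
Qed.

Lemma lucas_disc_even p q :
  (2 %| p)%Z -> lucas_disc p q = 4 * ((p %/ 2)%Z ^+ 2 + q).
Proof. by move=> p2; rewrite /lucas_disc -{1}(divzK p2); ring. Qed.

Lemma three_dvd_succ p q :
  ~~ (3 %| p)%Z -> (3 %| lucas_disc p q)%Z -> (3 %| q + 1)%Z.
Proof.
move=> p3 r3; have -> : q + 1 = lucas_disc p q - (p - 1) * (p + 1) - 3 * q.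
  by rewrite /lucas_disc; ring.
have p31 : (3 %| (p - 1) * (p + 1))%Z.
  have : (3 %| p - 1)%Z || (3 %| p + 1)%Z by lia.
  by rewrite (@Euclid_dvdzM 3).
by rewrite !rpredB // dvdz_mulr.
Qed.

Lemma admissible_prime_power p q s l k n :
    admissible p q s -> ~~ (3 %| q + 1)%Z \/ ~~ (3 %| s)%N ->
    prime l -> (l %| s)%N ->
  (l ^ k %| n)%N = (l%:Z ^+ k %| lucas_seq p q n)%Z.
Proof.
move=> adm not3 l_pr l_s.
have l_sZ : (l %| s%:Z)%Z by [].
have odd_case : (2 < l)%N -> ~~ (l %| p)%Z -> (l %| lucas_disc p q)%Z ->
    (l ^ k %| n)%N = (l%:Z ^+ k %| lucas_seq p q n)%Z.
  rewrite leq_eqVlt => /predU1P[l3 l_p l_r|l_gt3 l_p l_r]; last first.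
    exact: odd_prime_power_dvd_lucas_seq.
  (* The prime 3 cannot occur: it would divide both s and q + 1, against [not3]. *)
  move: l_p l_r l_s; rewrite -l3 => p3 r3 s3.
  by case: not3; rewrite ?s3 // (three_dvd_succ p3 r3).
have ndvd2 : (2 < l)%N -> (l %| 2)%Z = false.
  by move=> l_gt2; rewrite dvdzE /= gtnNdvd.
have coprime_case : (2 < l)%N -> gcdz p q = 1 -> (l %| lucas_disc p q)%Z ->
    (l ^ k %| n)%N = (l%:Z ^+ k %| lucas_seq p q n)%Z.
  move=> l_gt2 pq1 l_r; apply: odd_case => //.
  apply: (prime_ndvd_of_coprime l_pr _ pq1 l_r).
  by rewrite (_ : 4 = 2%Z * 2%Z) // Euclid_dvdzM // ndvd2.
have [l2|l_gt2] : l = 2%N \/ (2 < l)%N by have := prime_gt1 l_pr; lia.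
  (* The prime 2 survives only in case (b): in (a), 2 | r would make p even; in (c), s = l = 2
     contradicts s >= 3. *)
  case: adm => [[p_odd _ _ s_r]|[p_even aq1 _ s_D]|[_ s_ge3 s_pr _]].
  - case/negP: p_odd; have := dvdz_trans l_sZ s_r.
    rewrite l2 /lucas_disc rpredDr ?(@Euclid_dvdzX 2) ?andbT //.
    by rewrite (@Euclid_dvdzM 2).
  (* With a = p/2 prime to q, l = 2 divides r/4 = a^2 + q, so a and q are both odd. *)
  - move: s_D; rewrite lucas_disc_even // mulKz // => /(dvdz_trans l_sZ) l_D.
    have l_a : ~~ (l %| p %/ 2)%Z.
      apply: (prime_ndvd_of_coprime (c := 1) l_pr _ aq1).
        by rewrite dvdzE Euclid_dvd1.
      by rewrite mul1r; exact: l_D.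
    have l_q : ~~ (l %| q)%Z.
      apply: contra l_a => l_q; move: l_D.
      by rewrite rpredDr // Euclid_dvdzX // andbT.
    rewrite -(divzK p_even); rewrite l2 in l_a l_q *.
    exact: two_power_dvd_lucas_seq.
  - by move: l_s s_ge3; rewrite dvdn_prime2 // l2 => /eqP <-.
case: adm => [[_ pq1 _ s_r]|[p_even aq1 _ s_D]|[pq1 _ _ s_r]].
- exact: coprime_case (dvdz_trans l_sZ s_r).
- move: s_D; rewrite lucas_disc_even // mulKz // => /(dvdz_trans l_sZ) l_D.
  apply: odd_case => //; last by rewrite lucas_disc_even // dvdz_mull.
  rewrite -(divzK p_even) Euclid_dvdzM // ndvd2 // orbF.
  apply: (prime_ndvd_of_coprime (c := 1) l_pr _ aq1).
    by rewrite dvdzE Euclid_dvd1.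
  by rewrite mul1r; exact: l_D.
- exact: coprime_case (dvdz_trans l_sZ s_r).
Qed.

Theorem theorem1p1 (p q : int) (hr : lucas_disc p q != 0) :
  (forall s : nat, (0 < s)%N -> (s %| lucas_disc p q)%Z ->
     forall k n : nat,
       (s%:Z ^+ k * lucas_seq p q n %| lucas_seq p q (s ^ k * n)%N)%Z) /\
  (forall s : nat, admissible p q s ->
     ~~ (3 %| q + 1)%Z \/ ~~ (3 %| s)%N ->
     forall k n : nat,
       (s ^ k %| n)%N <-> (s%:Z ^+ k %| lucas_seq p q n)%Z).
Proof.
split=> [s s_gt0 s_r k n|s adm not3 k n]; first exact: dvdz_lucas_seqM.
have s_gt0 : (0 < s)%N by case: adm => -[] // _ /ltnW/ltnW.
rewrite (@dvd_lucas_seq_by_primes p q) ?expn_gt0 ?s_gt0 ?dvdzE ?abszX //.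
move=> l j l_pr; rewrite Euclid_dvdX // => /andP[l_s _].
exact: admissible_prime_power l_s.
Qed.
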